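(* Let $\preceq$ be a partial order in $\overline{\mathbb{R}}^d$ such that conditions (I1), (I2), (I3) of the context hold. Let $P$ be a probability measure on $\mathbb{R}^d$ and let $\mathcal{J}$ be a family of intervals with respect to the partial order $\preceq$, with the property that $P(J)>\frac12$ for each $J\in\mathcal{J}$. Then the intersection of all intervals from $\mathcal{J}$ is a non-empty compact interval.
   Context: $\overline{\mathbb{R}}=\mathbb{R}\cup\{-\infty,+\infty\}$. Probability measures on $\mathbb{R}^d$ are defined on its Borel sigma-field. For a partial order $\preceq$ in $\overline{\mathbb{R}}^d$ and arbitrary points $a,b\in\overline{\mathbb{R}}^d$, the ($d$-dimensional) interval is $[a,b]=\{x\in\mathbb{R}^d : a\preceq x\preceq b\}$, a subset of $\mathbb{R}^d$ (it can be empty or a singleton). A point is called finite if all its coordinates are finite, i.e. if it belongs to $\mathbb{R}^d$. Topological notions refer to the Euclidean topology of $\mathbb{R}^d$. The conditions are: (I1) Any interval $[a,b]$ is topologically closed, and for any $a,b\in\mathbb{R}^d$ (i.e., with finite coordinates) the interval $[a,b]$ is a compact set. (I2) For any ball $B\subset\mathbb{R}^d$ there exist $a,b\in\mathbb{R}^d$ such that $B\subset[a,b]$. (I3) For any set $S$ which is bounded from above (with respect to $\preceq$) by a finite point, there exists a finite $\sup S$. For any set $S$ which is bounded from below by a finite point, there exists a finite $\inf S$.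
   Formalization: Compactness fails for the family {R^d} in the componentwise order, so the compact-interval claim is stated for families with a compact member and for the family of all intervals with P>1/2; non-emptiness holds for every family. (I3) is read for nonempty sets of finite points. *)

(* Defs.v *)
From mathcomp Require Import all_boot all_order all_algebra.
From mathcomp Require Import all_classical all_reals all_analysis.

Set Implicit Arguments.
Unset Strict Implicit.
Unset Printing Implicit Defensive.

Import Order.TTheory GRing.Theory Num.Theory.
Import numFieldNormedType.Exports.

Local Open Scope classical_set_scope.
Local Open Scope ring_scope.

(* The library topology on 'rV[R]_d is that of the sup norm, i.e. the
   Euclidean topology; its Borel sets are generated by the open sets. *)
Notation borel_rV R d := (g_sigma_algebraType (@open 'rV[R]_d)).

Definition euclidean_ball (R : realType) (d : nat) (c : 'rV[R]_d) (r : R) :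
    set 'rV[R]_d :=
  [set x | Num.sqrt (\sum_(i < d) (x ord0 i - c ord0 i) ^+ 2) < r].

Definition finite_point (R : realType) (d : nat) (x : 'rV[R]_d) :
    'rV[\bar R]_d :=
  map_mx EFin x.

Section OrderOnExtendedSpace.
Variables (R : realType) (d : nat) (le : rel 'rV[\bar R]_d).

Definition partial_order : Prop :=
  [/\ reflexive le, antisymmetric le & transitive le].

(* The end points may be infinite, but only finite points are members. *)
Definition order_interval (a b : 'rV[\bar R]_d) : set 'rV[R]_d :=
  [set x | le a (finite_point x) && le (finite_point x) b].

Definition is_order_interval (A : set 'rV[R]_d) : Prop :=
  exists a b : 'rV[\bar R]_d, A = order_interval a b.

Definition upper_bound (S : set 'rV[\bar R]_d) (u : 'rV[\bar R]_d) : Prop :=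
  forall x, S x -> le x u.

Definition lower_bound (S : set 'rV[\bar R]_d) (l : 'rV[\bar R]_d) : Prop :=
  forall x, S x -> le l x.

(* Least and greatest are meant among all bounds in the extended space. *)
Definition is_sup (S : set 'rV[\bar R]_d) (s : 'rV[\bar R]_d) : Prop :=
  upper_bound S s /\ forall u, upper_bound S u -> le s u.

Definition is_inf (S : set 'rV[\bar R]_d) (s : 'rV[\bar R]_d) : Prop :=
  lower_bound S s /\ forall l, lower_bound S l -> le l s.

Definition condition_I1 : Prop :=
  (forall a b : 'rV[\bar R]_d, closed (order_interval a b)) /\
  (forall a b : 'rV[R]_d,
     compact (order_interval (finite_point a) (finite_point b))).

Definition condition_I2 : Prop :=
  forall (c : 'rV[R]_d) (r : R), 0 < r ->
  exists a b : 'rV[R]_d,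
    euclidean_ball c r `<=` order_interval (finite_point a) (finite_point b).

(* S ranges over the nonempty sets of finite points: already for the
   componentwise order, the supremum of the empty set or of the singleton
   of (-oo, ..., -oo) is not finite. *)
Definition condition_I3 : Prop :=
  (forall S : set 'rV[R]_d, S !=set0 ->
     (exists u : 'rV[R]_d,
        upper_bound ((@finite_point R d) @` S) (finite_point u)) ->
     exists s : 'rV[R]_d, is_sup ((@finite_point R d) @` S) (finite_point s)) /\
  (forall S : set 'rV[R]_d, S !=set0 ->
     (exists l : 'rV[R]_d,
        lower_bound ((@finite_point R d) @` S) (finite_point l)) ->
     exists s : 'rV[R]_d, is_inf ((@finite_point R d) @` S) (finite_point s)).

Definition heavy_intervals (P : probability (borel_rV R d) R) :
    set (set 'rV[R]_d) :=
  [set A | is_order_interval A /\ ((2^-1)%:E < P A)%E].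

Definition compact_interval (A : set 'rV[R]_d) : Prop :=
  is_order_interval A /\ compact A.

End OrderOnExtendedSpace.

(* Main.v *)
Require Import Defs.
From mathcomp Require Import all_boot all_order all_algebra.
From mathcomp Require Import all_classical all_reals all_analysis.

Set Implicit Arguments.
Unset Strict Implicit.
Unset Printing Implicit Defensive.

Import Order.TTheory GRing.Theory Num.Theory.
Import numFieldNormedType.Exports.
Local Open Scope classical_set_scope.
Local Open Scope ring_scope.

(** Any two intervals of probability greater than 1/2 meet, because their
    probabilities sum to more than 1.  The rest is a Helly theorem for
    intervals: if the intervals of a family pairwise meet and one of them has
    finite end points, then all of them have a common point.

    In one dimension such a common point is the supremum of the left end points,
    which lies below every right end point because the intervals pairwise meet.
    Here the end points may be infinite, while suprema and infima are only
    known to exist for finitely bounded sets of finite points.  The cure is to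
    trace everything on an interval K with finite end points: the trace of an
    interval on K, when not empty, is again an interval with finite end points,
    its own infimum and supremum ([bigcap_interval_finite_ends]).  The
    one-dimensional argument applies to these traces as soon as any two of them
    meet ([helly_in_finite_interval]).

    That any two traces on a heavy K meet means that any three heavy intervals
    have a common point.  This is again the case of traces that pairwise meet,
    on another finite interval: one so large that it contains a point of each
    pairwise intersection ([three_intervals_meet]).  A heavy K exists
    because balls exhaust the space and each ball lies in a finite interval.

    Finally, a nonempty intersection of intervals inside a compact set is
    bounded, so it is the interval between its infimum and its supremum, and
    intervals with finite end points are compact. *)

(** * Intervals traced on a finite interval *)

Section Intervals.
Variables (R : realType) (d : nat) (le : rel 'rV[\bar R]_d).
Hypothesis le_po : partial_order le.
Hypothesis I3 : condition_I3 le.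

Local Notation fin := (@finite_point R d).
Local Notation interval := (order_interval le).
Local Notation finite_interval a b := (interval (fin a) (fin b)).

(** The end points are the infimum and the supremum of the intersection: the
    lower end point of a member, finite or not, is a lower bound of the
    intersection, hence below its infimum, and dually for the upper one. *)
Lemma bigcap_interval_finite_ends (J : set (set 'rV[R]_d)) (a b : 'rV[R]_d) :
    (forall A, J A -> is_order_interval le A) ->
    \bigcap_(A in J) A !=set0 ->
    \bigcap_(A in J) A `<=` finite_interval a b ->
  exists s t : 'rV[R]_d, \bigcap_(A in J) A = finite_interval s t.
Proof.
case: le_po => _ _ le_trans; case: I3 => has_sup has_inf Jint S0 Sab.
set S := \bigcap_(A in J) A in S0 Sab *.
have [|t [tub tleast]] := has_sup S S0.
  by exists b => _ [x /Sab/andP[_ xb] <-].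
have [|s [slb sgreatest]] := has_inf S S0.
  by exists a => _ [x /Sab/andP[ax _] <-].
exists s, t; apply/seteqP; split => x.
  by move=> Sx; apply/andP; split; [apply: slb | apply: tub]; exists x.
move=> /andP[sx xt] A JA; have [a' [b' Aeq]] := Jint A JA.
have ends y : S y -> le a' (fin y) && le (fin y) b'.
  by move=> /(_ A JA); rewrite Aeq.
rewrite Aeq; apply/andP; split.
  by apply: le_trans sx; apply: sgreatest => _ [y /ends/andP[a'y _] <-].
by apply: (le_trans _ _ _ xt); apply: tleast => _ [y /ends/andP[_ yb'] <-].
Qed.

Lemma setI_interval_finite_ends (A : set 'rV[R]_d) (a b : 'rV[R]_d) :
    is_order_interval le A -> A `&` finite_interval a b !=set0 ->
  exists s t : 'rV[R]_d, A `&` finite_interval a b = finite_interval s t.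
Proof.
move=> Aint AK0; set K := finite_interval a b in AK0 *.
have capE : \bigcap_(B in [set A; K]) B = A `&` K.
  apply/seteqP; split=> [x capx|x [Ax Kx] B [->|->]//].
  by split; apply: capx; [left | right].
rewrite -capE; apply: (bigcap_interval_finite_ends (a := a) (b := b)); rewrite ?capE //.
  by move=> B [->//|->]; exists (fin a), (fin b).
Qed.

(** The common point is the supremum of the lower end points of the traces on
    the finite interval: as any two traces meet, each lower end point lies below
    each upper one. *)
Lemma helly_in_finite_interval (J : set (set 'rV[R]_d)) (a b : 'rV[R]_d) :
    J !=set0 -> (forall A, J A -> is_order_interval le A) ->
    (forall A B, J A -> J B -> A `&` B `&` finite_interval a b !=set0) ->
  \bigcap_(A in J) A !=set0.
Proof.
case: le_po => le_refl _ le_trans; case: I3 => has_sup _ J0 Jint Jmeet.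
set K := finite_interval a b in Jmeet *.
have trace A : J A -> exists s t, A `&` K = finite_interval s t.
  move=> JA; apply: setI_interval_finite_ends; first exact: Jint.
  by have [x [[Ax _] Kx]] := Jmeet A A JA JA; exists x.
pose lows := [set s | exists A t, J A /\ A `&` K = finite_interval s t].
have lows_le B s' t' : J B -> B `&` K = finite_interval s' t' ->
    upper_bound le (fin @` lows) (fin t').
  move=> JB BK _ [s [A [t [JA AK]]] <-].
  have [x [[Ax Bx] Kx]] := Jmeet A B JA JB.
  have /andP[sx _] : finite_interval s t x by rewrite -AK.
  have /andP[_ xt'] : finite_interval s' t' x by rewrite -BK.
  exact: le_trans xt'.
have [B JB] := J0; have [s [t BK]] := trace B JB.
have [||z [zub zleast]] := has_sup lows.
- by exists s, B, t.
- by exists t; apply: lows_le BK.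
exists z => A JA; have [s' [t' AK]] := trace A JA.
suff : (A `&` K) z by case.
rewrite AK; apply/andP; split; last exact: zleast (lows_le _ _ _ JA AK).
by apply: zub; exists s' => //; exists A, t'.
Qed.

End Intervals.

(** * Bounded sets lie in finite intervals *)

Section BoundedSets.
Variables (R : realType) (d : nat) (le : rel 'rV[\bar R]_d).
Hypothesis I2 : condition_I2 le.

Local Notation fin := (@finite_point R d).
Local Notation finite_interval a b := (order_interval le (fin a) (fin b)).

(** The norm is the sup norm: its ball of radius M lies in the Euclidean ball of
    any radius larger than M times the square root of d. *)
Lemma norm_le_finite_interval (M : R) :
  exists a b : 'rV[R]_d, [set x | `|x| <= M] `<=` finite_interval a b.
Proof.
have r0 : 0 < Num.sqrt (M ^+ 2 *+ d) + 1 :> R by rewrite ltr_wpDl ?sqrtr_ge0.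
have [a [b ballab]] := I2 0 r0; exists a, b.
apply: subset_trans ballab => x /= xM; rewrite /euclidean_ball /=.
rewrite (@le_lt_trans _ _ (Num.sqrt (M ^+ 2 *+ d))) ?ltrDl //.
apply: ler_wsqrtr; rewrite -[d in leRHS]card_ord -sumr_const.
apply: ler_sum => i _; rewrite mxE subr0 -real_normK ?num_real //.
have xiM : `|x ord0 i| <= M.
  apply: le_trans xM; rewrite [leRHS]/Num.Def.normr /= mx_normrE.
  by apply/bigmax_geP; right => /=; exists (ord0, i).
by rewrite lerXn2r ?nnegrE // (le_trans _ xiM).
Qed.

Lemma compact_finite_interval (A : set 'rV[R]_d) : compact A ->
  exists a b : 'rV[R]_d, A `<=` finite_interval a b.
Proof.
move=> /compact_bounded[M [_ Mbound]].
have [a [b subab]] := norm_le_finite_interval (M + 1); exists a, b.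
by move=> x Ax; apply: subab; apply: (Mbound (M + 1)) Ax; rewrite ltrDl.
Qed.

Lemma three_points_finite_interval (x y z : 'rV[R]_d) :
  exists a b : 'rV[R]_d, [/\ finite_interval a b x, finite_interval a b y
                           & finite_interval a b z].
Proof.
have [a [b subab]] :=
  norm_le_finite_interval (Num.max `|x| (Num.max `|y| `|z|)).
by exists a, b; split; apply: subab; rewrite /= !le_max lexx ?orbT.
Qed.

(** A finite interval that contains a point of each pairwise intersection
    reduces the claim to traces that pairwise meet. *)
Lemma three_intervals_meet (A B C : set 'rV[R]_d) :
    partial_order le -> condition_I3 le ->
    is_order_interval le A -> is_order_interval le B ->
    is_order_interval le C ->
    A `&` B !=set0 -> A `&` C !=set0 -> B `&` C !=set0 ->
  A `&` B `&` C !=set0.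
Proof.
move=> le_po I3 Aint Bint Cint [x [Ax Bx]] [y [Ay Cy]] [z [Bz Cz]].
have [a [b [Kx Ky Kz]]] := three_points_finite_interval x y z.
pose J := [set D | [\/ D = A, D = B | D = C]].
have [|||w capw] := helly_in_finite_interval le_po I3 (J := J) (a := a) (b := b).
- by exists A; apply: Or31.
- by move=> D [] ->.
- move=> D E [] -> [] ->;
  by [exists x | exists y | exists z].
- exists w; split; [split|]; apply: capw;
  by [apply: Or31 | apply: Or32 | apply: Or33].
Qed.

End BoundedSets.

(** * Heavy sets *)

Section Heavy.
Variables (R : realType) (d : nat) (P : probability (borel_rV R d) R).

Lemma closed_borel_measurable (A : set 'rV[R]_d) :
  closed A -> measurable (A : set (borel_rV R d)).
Proof.
move=> Acl; rewrite -[A]setCK; apply: measurableC.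
by apply: sub_sigma_algebra; apply: closed_openC.
Qed.

Lemma heavy_sets_meet (A B : set 'rV[R]_d) : closed A -> closed B ->
  ((2^-1)%:E < P A)%E -> ((2^-1)%:E < P B)%E -> A `&` B !=set0.
Proof.
move=> /closed_borel_measurable mA /closed_borel_measurable mB PA PB.
apply/set0P/eqP => AB0.
have : (P (A `|` B) <= 1)%E by apply: probability_le1; apply: measurableU.
rewrite measureU // leNgt => /negP; apply.
have -> : (1 = (2^-1)%:E + (2^-1)%:E :> \bar R)%E.
  by rewrite -EFinD -div1r -splitr.
exact: lteD.
Qed.

(** Continuity from below along the balls around the origin. *)
Lemma exists_heavy_ball :
  exists n : nat, ((2^-1)%:E < P (ball 0 n%:R : set 'rV[R]_d)%R)%E.
Proof.
pose B n : set (borel_rV R d) := ball (0 : 'rV[R]_d) n%:R.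
have mB n : measurable (B n).
  by apply: sub_sigma_algebra; apply: ball_open.
have BT : \bigcup_n B n = setT.
  apply/seteqP; split => // x _; exists (Num.truncn `|x : 'rV[R]_d|).+1 => //.
  by rewrite /B -ball_normE /= sub0r normrN truncnS_gt.
have homoB : {homo B : n m / (n <= m)%N >-> (n <= m)%O}.
  by move=> n m nm; apply/subsetPset; apply: le_ball; rewrite ler_nat.
have PB : P (\bigcup_n B n) = 1%E by rewrite BT; exact: probability_setT.
have half1 : ((2^-1)%:E < P (\bigcup_n B n))%E.
  by rewrite PB lte_fin invf_lt1 ?ltr1n.
have Bcvg : P (B n) @[n --> \oo] --> P (\bigcup_n B n).
  exact: nondecreasing_cvg_mu mB (bigcupT_measurable _ mB) homoB.
have [n _ nbig] := Bcvg _ (open_ereal_gt' half1).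
by exists n; apply: (nbig n) => /=.
Qed.

Lemma exists_heavy_finite_interval (le : rel 'rV[\bar R]_d) :
    condition_I1 le -> condition_I2 le ->
  exists a b : 'rV[R]_d,
    ((2^-1)%:E < P (order_interval le (finite_point a) (finite_point b)))%E.
Proof.
move=> [clI _] I2; have [n heavy] := exists_heavy_ball.
have [a [b subab]] := norm_le_finite_interval I2 n%:R; exists a, b.
apply: (lt_le_trans heavy); apply: le_measure; rewrite ?inE.
- by apply: sub_sigma_algebra; apply: ball_open.
- exact: closed_borel_measurable.
- apply: subset_trans subab => x.
  by rewrite -ball_normE /= sub0r normrN => /ltW.
Qed.

End Heavy.

(** * Intersections of heavy intervals *)

(** A compact member makes the intersection bounded, hence an interval with
    finite end points, and those are compact. *)
Lemma compact_interval_bigcap (R : realType) (d : nat)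
    (le : rel 'rV[\bar R]_d) (J : set (set 'rV[R]_d)) :
    partial_order le -> condition_I1 le -> condition_I2 le ->
    condition_I3 le ->
    (forall A, J A -> is_order_interval le A) ->
    \bigcap_(A in J) A !=set0 -> (exists2 A, J A & compact A) ->
  compact_interval le (\bigcap_(A in J) A).
Proof.
move=> le_po [_ cptI] I2 I3 Jint capJ [A JA /(compact_finite_interval I2)].
move=> [a [b Aab]].
have [|s [t ->]] := bigcap_interval_finite_ends le_po I3 Jint capJ (a:=a) (b:=b).
  by apply: subset_trans Aab; apply: bigcap_inf.
by split; [exists (finite_point s), (finite_point t) | exact: cptI].
Qed.

(* A compact member is needed for compactness: for the componentwise order the
   family whose only member is the whole space, as well as the empty family,
   has a noncompact intersection.  The family of all intervals of probability
   greater than 1/2 has such a member, and needs no extra hypothesis. *)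
Theorem theorem2p1 (R : realType) (d : nat) (le : rel 'rV[\bar R]_d)
  (le_po : partial_order le)
  (I1 : condition_I1 le) (I2 : condition_I2 le) (I3 : condition_I3 le)
  (P : probability (borel_rV R d) R)
  (J : set (set 'rV[R]_d))
  (J_intervals : forall A, J A -> is_order_interval le A)
  (J_heavy : forall A, J A -> ((2^-1)%:E < P A)%E) :
  [/\ \bigcap_(A in J) A !=set0,
      (exists2 A, J A & compact A) -> compact_interval le (\bigcap_(A in J) A)
    & \bigcap_(A in heavy_intervals le P) A !=set0 /\
      compact_interval le (\bigcap_(A in heavy_intervals le P) A)].
Proof.
have [clI cptI] := I1.
pose H := heavy_intervals le P.
have Hint A : H A -> is_order_interval le A by case.
have [a [b Kheavy]] := exists_heavy_finite_interval P I1 I2.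
set K := order_interval le _ _ in Kheavy.
have HK : H K by split=> //; exists (finite_point a), (finite_point b).
have Hmeet A B : H A -> H B -> A `&` B !=set0.
  move=> [[u [v ->]] PA] [[u' [v' ->]] PB].
  exact: heavy_sets_meet PA PB.
have capH : \bigcap_(A in H) A !=set0.
  apply: (helly_in_finite_interval le_po I3 (a := a) (b := b)) => //.
    by exists K.
  by move=> A B HA HB; apply: three_intervals_meet; auto.
have JH : J `<=` H by move=> A JA; split; [exact: J_intervals | exact: J_heavy].
have capJ : \bigcap_(A in J) A !=set0.
  by have [x capx] := capH; exists x => A /JH; apply: capx.
split=> //; first exact: compact_interval_bigcap.
split=> //; apply: compact_interval_bigcap => //.
by exists K => //; apply: cptI.
Qed.
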